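(* Let $k$, $p$, $v$ and $w$ be positive integers with $k > p$. Let $a, b, m$ be the unique integers with $v = \binom{a}{k} + \binom{b}{k-1} + m$, $a > b$ and $\binom{b}{k-2} > m \ge 0$. If $$w \ge \binom{a}{p} + \binom{b}{p-1} + c_p^k(m),$$ then the construction described below (applied with target numbers $v$ and $w$) does not fail and produces a flag complex $\Delta$ with $f_{k-1}(\Delta) = v$ and $f_{p-1}(\Delta) = w$.
   Context: A simplicial complex $\Delta$ on a vertex set is a family of subsets (faces) closed under taking subsets and containing all singletons; $f_{i-1}(\Delta)$ is the number of faces with $i$ vertices. A flag complex is a simplicial complex in which every minimal non-face has two elements; equivalently, it is the clique complex of a graph (faces = vertex sets of cliques). Binomial coefficients follow the convention $\binom{n}{j} = 0$ if $n < j$. For an integer $m > 0$, $g_k(m)$ is the unique integer with $\binom{g_k(m)}{k-1} \le m < \binom{g_k(m)+1}{k-1}$, and $c_p^k$ is defined on integers $m \ge 0$ by $c_p^k(0) = 0$ and $c_p^k(m) = \binom{g_k(m)}{p-1} + c_p^k\!\left(m - \binom{g_k(m)}{k-1}\right)$ for $m > 0$. The construction (target $f_{k-1} = v$, $f_{p-1} = w$): let $n_0$ be the unique integer with $\binom{n_0}{k} \le v < \binom{n_0+1}{k}$, and $m_0 = v - \binom{n_0}{k}$. For $i \ge 1$: if $m_{i-1} = 0$, set $z = i-1$ and stop; otherwise let $n_i$ be the unique integer with $\binom{n_i}{k-1} \le m_{i-1} < \binom{n_i+1}{k-1}$ and $m_i = m_{i-1} - \binom{n_i}{k-1}$. Form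 the graph consisting of a clique on $n_0$ vertices together with $z$ further vertices $v_1, \dots, v_z$, where $v_i$ is adjacent to exactly $n_i$ vertices of the clique (and to no other vertices), and let $\Delta$ be its clique complex. If $f_{p-1}(\Delta) > w$ the construction fails. Otherwise add $w - f_{p-1}(\Delta)$ new vertices, each adjacent to exactly $p-1$ vertices of the original $n_0$-clique, and take the clique complex of the resulting graph. *)

(* Defs.v *)
From HB Require Import structures.
From mathcomp Require Import all_boot.

Set Implicit Arguments.
Unset Strict Implicit.
Unset Printing Implicit Defensive.

(* For j > 0, the unique n with 'C(n, j) <= m < 'C(n.+1, j); see bin_floorP and
   bin_floor_uniq. A negative n is impossible, since then 'C(n + 1, j) = 0.
   The range is large enough because 'C(n, j) >= n - j + 1 when n >= j. *)
Definition bin_floor (j m : nat) : nat :=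
  \max_(n < (m + j).+1 | 'C(n, j) <= m) n.

Lemma leq_bin_sub j n : 0 < j -> n.+1 - j <= 'C(n, j).
Proof.
move=> j0; elim: n => [|n IHn]; first by case: j j0 => // j _; rewrite subSS sub0n.
case: (leqP j n.+1) => [le_jn|lt_nj]; last first.
  by move: lt_nj; rewrite -subn_eq0 => /eqP ->.
rewrite subSn //; case: j j0 le_jn IHn => // j _ le_jn IHn.
rewrite binS -addn1; apply: leq_add; first exact: IHn.
by rewrite bin_gt0.
Qed.

Lemma bin_floorP j m : 0 < j ->
  'C(bin_floor j m, j) <= m < 'C((bin_floor j m).+1, j).
Proof.
move=> j0; apply/andP; split.
  rewrite /bin_floor; elim/big_ind: _ => // [|x y lex ley]; last by rewrite /maxn; case: ifP.
  by rewrite bin0n; case: j j0.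
rewrite ltnNge; apply/negP => le_m.
have lt_n : (bin_floor j m).+1 < (m + j).+1.
  have := leq_trans (leq_bin_sub _ j0) le_m.
  by rewrite leq_subLR addnC ltnS => /ltnW.
have := @leq_bigmax_cond _ (fun n : 'I_(m + j).+1 => 'C(n, j) <= m)
  (fun n => nat_of_ord n) (Ordinal lt_n) le_m.
by rewrite /= -/(bin_floor j m) ltnn.
Qed.

Lemma bin_floor_uniq j m n : 0 < j ->
  'C(n, j) <= m < 'C(n.+1, j) -> n = bin_floor j m.
Proof.
move=> j0 /andP[le_n lt_n]; have /andP[le_f lt_f] := bin_floorP m j0.
apply/eqP; rewrite eqn_leq; apply/andP; split; rewrite leqNgt; apply/negP => le_S.
  by have := leq_trans lt_f (leq_trans (leq_bin2l _ le_S) le_n); rewrite ltnn.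
by have := leq_trans lt_n (leq_trans (leq_bin2l _ le_S) le_f); rewrite ltnn.
Qed.

(* Every positive v has exactly one decomposition of this shape. *)
Lemma binomial_decomposition k v : 1 < k -> 0 < v ->
  exists! abm : nat * nat * nat, let: (a, b, m) := abm in
    [/\ v = 'C(a, k) + 'C(b, k.-1) + m, b < a & m < 'C(b, k.-2)].
Proof.
case: k => [|[|k]] // _ v0 /=.
have /andP[le_a lt_a] := @bin_floorP k.+2 v isT.
set a := bin_floor k.+2 v in le_a lt_a.
have /andP[le_b lt_b] := @bin_floorP k.+1 (v - 'C(a, k.+2)) isT.
set b := bin_floor k.+1 _ in le_b lt_b.
exists (a, b, v - 'C(a, k.+2) - 'C(b, k.+1)); split.
  split; first by rewrite -addnA subnKC ?subnKC.
    rewrite ltnNge; apply/negP => le_ab.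
    have : 'C(a, k.+1) <= v - 'C(a, k.+2) by apply: leq_trans le_b; apply: leq_bin2l.
    by rewrite leqNgt ltn_subLR // -binS lt_a.
  by rewrite ltn_subLR // -binS.
case=> [[a' b'] m'] [Ev lt_ba lt_m].
have lt1 : 'C(b', k.+1) + m' < 'C(b'.+1, k.+1) by rewrite binS ltn_add2l.
have Ea : a' = a.
  apply: bin_floor_uniq => //; rewrite Ev -addnA leq_addr /= binS ltn_add2l.
  by apply: leq_trans lt1 _; apply: leq_bin2l.
have Er : v - 'C(a, k.+2) = 'C(b', k.+1) + m' by rewrite Ev Ea -addnA addKn.
have Eb : b' = b by apply: bin_floor_uniq => //; rewrite Er leq_addr.
by rewrite Er Ea -Eb addKn.
Qed.

Definition g (k m : nat) : nat := bin_floor k.-1 m.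

Lemma bin_g_gt0 k m : 1 < k -> 0 < m -> 0 < 'C(g k m, k.-1).
Proof.
case: k => // k k0 m0; rewrite bin_gt0 leqNgt; apply/negP => lt_g.
have /andP[_] := @bin_floorP k m k0.
move: lt_g; rewrite /g /= leq_eqVlt => /orP[/eqP->|lt_g].
  by rewrite binn ltnNge m0.
by rewrite bin_small.
Qed.

(* Recursion on a bound on m, which decreases at each step when k >= 2; the
   defining equations are ck0 and ckE. *)
Fixpoint ck_rec (fuel p k m : nat) : nat :=
  if fuel is fuel'.+1 then
    if m == 0 then 0
    else 'C(g k m, p.-1) + ck_rec fuel' p k (m - 'C(g k m, k.-1))
  else 0.
Definition ck (p k m : nat) : nat := ck_rec m p k m.

Lemma ck0 p k : ck p k 0 = 0. Proof. by []. Qed.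

Lemma ckE p k m : 1 < k -> 0 < m ->
  ck p k m = 'C(g k m, p.-1) + ck p k (m - 'C(g k m, k.-1)).
Proof.
move=> k1.
have rec f1 f2 q : q <= f1 -> q <= f2 -> ck_rec f1 p k q = ck_rec f2 p k q.
  elim: f1 f2 q => [|f1 IH] [|f2] q //=; rewrite ?leqn0.
  - by move=> ->.
  - by move=> _ ->.
  move=> le1 le2; case: eqP => // /eqP; rewrite -lt0n => q0; congr (_ + _).
  have lt_q : q - 'C(g k q, k.-1) < q by rewrite ltn_subrL bin_g_gt0.
  by apply: IH; rewrite -ltnS; apply: leq_trans lt_q _.
case: m => // m m0; rewrite {1}/ck /=; congr (_ + _); apply: rec => //.
by rewrite -ltnS ltn_subrL bin_g_gt0.
Qed.

Section Complexes.

Variable V : finType.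
Implicit Types (D : {set {set V}}) (e : rel V) (A : {set V}).

Definition simplicial_complex D : Prop :=
  (forall A B : {set V}, B \in D -> A \subset B -> A \in D) /\
  (forall x : V, [set x] \in D).

Definition flag_complex D : Prop :=
  simplicial_complex D /\
  (forall A, minset (fun B : {set V} => B \notin D) A -> #|A| = 2).

(* Indexed by number of vertices: nfaces D i is f_{i-1}(D). *)
Definition nfaces D (i : nat) : nat := #|[set A in D | #|A| == i]|.

Definition clique e A : bool :=
  [forall x in A, forall y in A, (x != y) ==> e x y].

Definition clique_complex e : {set {set V}} := [set A | clique e A].

End Complexes.

Definition complete_graph (n : nat) : rel 'I_n := fun x y => x != y.

(* The graph e with new, pairwise non-adjacent vertices t : T, where t is
   adjacent exactly to the elements of N t. *)
Definition add_vertices (V T : finType) (e : rel V) (N : T -> {set V}) :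
    rel (V + T)%type :=
  fun x y => match x, y with
  | inl x', inl y' => e x' y'
  | inl x', inr t => x' \in N t
  | inr t, inl y' => y' \in N t
  | inr _, inr _ => false
  end.

Section Construction.

Variables k p v w : nat.

Definition n0 : nat := bin_floor k v.

Fixpoint m_ (i : nat) : nat :=
  if i is i'.+1 then m_ i' - 'C(bin_floor k.-1 (m_ i'), k.-1)
  else v - 'C(n0, k).

(* Only meant for i >= 1; the initial n_0 is n0 above. *)
Definition n_ (i : nat) : nat := bin_floor k.-1 (m_ i.-1).

(* The first index at which m_ vanishes; the range suffices when k >= 2. *)
Definition z : nat := find (fun i => m_ i == 0) (iota 0 v.+1).

Lemma zP : 1 < k -> m_ z = 0 /\ (forall i, i < z -> 0 < m_ i).
Proof.
move=> k1; have le_m i : m_ i <= v - i.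
  elim: i => [|i IH]; first by rewrite subn0 leq_subr.
  have [m0|] := posnP (m_ i); first by rewrite /= m0 sub0n.
  move=> m0; rewrite subnS -ltnS; apply: leq_trans (leqSpred _).
  by apply: leq_trans IH; rewrite /= ltn_subrL m0 andbT; exact: bin_g_gt0.
have hasz : has (fun i => m_ i == 0) (iota 0 v.+1).
  apply/hasP; exists v; first by rewrite mem_iota /= add0n ltnSn.
  by rewrite -leqn0 -(subnn v).
have ltz : z < v.+1 by rewrite -(size_iota 0 v.+1) -has_find.
split=> [|i lt_i]; first by have /eqP := nth_find 0 hasz; rewrite nth_iota.
by have := before_find 0 lt_i; rewrite nth_iota ?(ltn_trans lt_i) // lt0n => ->.
Qed.

(* N1 i is the neighbourhood of the vertex v_{i+1} : indices in 'I_z start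
   at 0. *)
Definition first_choice (N1 : 'I_z -> {set 'I_n0}) : Prop :=
  forall i : 'I_z, #|N1 i| = n_ i.+1.

Definition first_graph (N1 : 'I_z -> {set 'I_n0}) : rel ('I_n0 + 'I_z)%type :=
  add_vertices (@complete_graph n0) N1.

Definition first_complex (N1 : 'I_z -> {set 'I_n0}) :=
  clique_complex (first_graph N1).

Definition construction_fails (N1 : 'I_z -> {set 'I_n0}) : bool :=
  w < nfaces (first_complex N1) p.

(* The subtraction is truncated, hence only meaningful when the construction
   does not fail. *)
Definition missing (N1 : 'I_z -> {set 'I_n0}) : nat :=
  w - nfaces (first_complex N1) p.

Definition second_choice (N1 : 'I_z -> {set 'I_n0})
    (N2 : 'I_(missing N1) -> {set 'I_n0}) : Prop :=
  forall j : 'I_(missing N1), #|N2 j| = p.-1.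

Definition final_graph (N1 : 'I_z -> {set 'I_n0})
    (N2 : 'I_(missing N1) -> {set 'I_n0}) :
    rel (('I_n0 + 'I_z) + 'I_(missing N1))%type :=
  add_vertices (first_graph N1) (fun j => [set inl x | x in N2 j]).

Definition final_complex (N1 : 'I_z -> {set 'I_n0})
    (N2 : 'I_(missing N1) -> {set 'I_n0}) :=
  clique_complex (final_graph N2).

End Construction.

(* Main.v *)
(** A vertex whose neighbourhood is a clique [N] lies in ['C(#|N|, i)] faces
    with [i.+1] vertices, so the face numbers of both stages of the construction
    are explicit sums of binomial coefficients. Since [n0 = a] and [n_1 = b],
    the sum over the vertices [v_i] unfolds the recursion of [c_p^k]; a vertex
    with [p-1] neighbours adds one face with [p] vertices and, as [p < k], none
    with [k] vertices. *)
Require Import Defs.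
From mathcomp Require Import all_boot.

Set Implicit Arguments.
Unset Strict Implicit.
Unset Printing Implicit Defensive.

(** * Clique complexes and flagness *)

Lemma cliqueP (V : finType) (e : rel V) (A : {set V}) :
  reflect {in A &, forall x y, x != y -> e x y} (clique e A).
Proof.
apply: (iffP forall_inP) => [cA x y xA yA|cA x xA].
  by move/forall_inP: (cA x xA) => /(_ y yA) /implyP.
by apply/forall_inP => y yA; apply/implyP; exact: cA.
Qed.

Lemma clique_sub (V : finType) (e : rel V) (A B : {set V}) :
  A \subset B -> clique e B -> clique e A.
Proof.
move=> /subsetP sAB /cliqueP cB; apply/cliqueP => x y xA yA.
by apply: cB; exact: sAB.
Qed.

(** A non-clique contains two distinct non-adjacent vertices; they already form a non-face, so a
    minimal non-face is that pair. *)
Lemma clique_complex_flag (V : finType) (e : rel V) :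
  flag_complex (clique_complex e).
Proof.
split; first split.
- by move=> A B; rewrite !inE => cB sAB; exact: clique_sub cB.
- move=> x; rewrite inE; apply/cliqueP => y z; rewrite !inE => /eqP-> /eqP->.
  by rewrite eqxx.
move=> A /minsetP[]; rewrite inE => ncA minA.
have [x xA] := forall_inPn ncA.
case/forall_inPn => y yA; rewrite negb_imply => /andP[neq_xy nexy].
have <- : [set x; y] = A; last by rewrite cards2 neq_xy.
apply: minA; last by apply/subsetP => t; rewrite !inE => /orP[]/eqP->.
rewrite inE; apply: contra nexy => /cliqueP; apply; rewrite ?inE ?eqxx ?orbT //.
Qed.

Lemma nfaces_complete_graph n i :
  nfaces (clique_complex (@complete_graph n)) i = 'C(n, i).
Proof.
rewrite -[n in RHS]card_ord -card_draws; apply: eq_card => A; rewrite !inE.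
by rewrite (_ : clique _ _ = true) //; apply/cliqueP => x y _ _.
Qed.

(** * Face numbers after attaching independent vertices *)

Section AddVertices.

Variables (V T : finType) (e : rel V) (N : T -> {set V}).

Let base (A : {set V}) : {set V + T} := [set inl x | x in A].

Let cone (u : T * {set V}) : {set V + T} :=
  inr u.1 |: base u.2.

Lemma base_inj : injective base.
Proof. by apply: imset_inj => x y []. Qed.

Lemma mem_base (A : {set V}) x : (inl x \in base A) = (x \in A).
Proof. by rewrite mem_imset // => y z []. Qed.

Lemma inr_notin_base (A : {set V}) t :
  inr t \notin base A.
Proof. by apply/imsetP => -[]. Qed.

Lemma clique_base (A : {set V}) :
  clique (add_vertices e N) (base A) = clique e A.
Proof.
apply/cliqueP/cliqueP => cA.
  by move=> x y xA yA neq; apply: (cA (inl x) (inl y)); rewrite ?mem_base.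
move=> _ _ /imsetP[x xA ->] /imsetP[y yA ->] neq; exact: cA.
Qed.

(** Subsets of the clique [N t] are cliques, so only adjacency to [t] has to be checked. *)
Lemma clique_cone t (A : {set V}) : clique e (N t) ->
  clique (add_vertices e N) (cone (t, A)) = (A \subset N t).
Proof.
move=> cN; apply/cliqueP/subsetP => [cA x xA|/subsetP sA].
  by apply: (cA (inl x) (inr t)); rewrite ?setU11 // setU1r ?mem_base.
have /cliqueP cA := clique_sub sA cN; move/subsetP: sA => sA.
move=> [x|s] [y|s'] /setU1P[]; rewrite ?mem_base ?(negPf (inr_notin_base _ _)) //.
- move=> xA /setU1P[] //; rewrite mem_base => yA neq; exact: cA.
- by move=> xA /setU1P[[->] _|]; [exact: sA | rewrite (negPf (inr_notin_base _ _))].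
- by move=> [->] /setU1P[] //; rewrite mem_base => yA _; exact: sA.
- move=> [->] /setU1P[[->]|]; first by rewrite eqxx.
  by rewrite (negPf (inr_notin_base _ _)).
Qed.

(** New vertices are pairwise non-adjacent, so a face contains at most one of them: it is either an
    old face ([S0]) or a new vertex [t] joined to an [i]-subset of [N t] ([S1]). *)
Lemma nfaces_add_vertices i : (forall t, clique e (N t)) ->
  nfaces (clique_complex (add_vertices e N)) i.+1 =
    nfaces (clique_complex e) i.+1 + \sum_t 'C(#|N t|, i).
Proof.
move=> cN; set S := [set A in clique_complex (add_vertices e N) | #|A| == i.+1].
pose S0 := [set A in clique_complex e | #|A| == i.+1].
pose S1 := [set u : T * {set V} | (u.2 \subset N u.1) && (#|u.2| == i)].
have cardcone u : #|cone u| = #|u.2|.+1.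
  by rewrite cardsU1 inr_notin_base card_imset // => x y [].
have cone_inj : injective cone.
  move=> [t A] [s B] /setP E.
  have := E (inr t); rewrite !inE eqxx /= (negPf (inr_notin_base _ _)) orbF.
  move=> /esym/eqP[->]; congr (_, _); apply/setP => x.
  by have := E (inl x); rewrite !inE /= !mem_base.
have defS : S = base @: S0 :|: cone @: S1.
  apply/setP => A; apply/idP/setUP; last first.
    case=> /imsetP[].
      move=> B; rewrite !inE => /andP[cB cardB] ->.
      by rewrite clique_base cB card_imset // => x y [].
    move=> [t B]; rewrite !inE /= => /andP[sB cardB] ->.
    by rewrite clique_cone // sB cardcone.
  rewrite !inE => /andP[cA cardA]; pose B := [set x | inl x \in A].
  have [[t tA]|noT] := altP (@existsP _ (fun t : T => inr t \in A)).
    have defA : A = cone (t, B).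
      apply/setP=> -[x|s]; rewrite !inE /= ?mem_base ?inE //.
      rewrite (negPf (inr_notin_base _ _)) orbF; apply/idP/eqP => [sA|[->//]].
      (* Two distinct new vertices in the clique [A] would have to be adjacent. *)
      apply/eqP; apply: contraT => neq.
      by move/cliqueP: cA => /(_ _ _ sA tA neq).
    right; apply/imsetP; exists (t, B) => //; rewrite inE /=.
    by move: cA cardA; rewrite defA clique_cone // cardcone eqSS => -> ->.
  have defA : A = base B.
    apply/setP=> -[x|s]; rewrite ?mem_base ?inE //.
    rewrite (negPf (inr_notin_base _ _)); apply/negbTE.
    by move/existsPn: noT; apply.
  left; apply/imsetP; exists B => //; rewrite !inE -clique_base -defA cA /=.
  by move: cardA; rewrite {1}defA card_imset // => x y [].
(* The two images are disjoint: a cone contains some [inr t], a base set does not. *)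
rewrite /nfaces -/S defS cardsU (_ : _ :&: _ = set0) ?cards0 ?subn0; last first.
  apply/setP => A; rewrite !inE; apply/andP => -[/imsetP[B _ ->]].
  move=> /imsetP[[t C] _] /setP /(_ (inr t)).
  by rewrite !inE eqxx (negPf (inr_notin_base _ _)).
rewrite (card_imset _ base_inj) (card_imset _ cone_inj); congr (_ + _).
(* The conjunct [true] is the trivial condition on [t], giving the shape in which the sum over pairs
   splits into a double sum. *)
rewrite -sum1_card (eq_bigl (fun u : T * {set V} =>
  true && ((u.2 \subset N u.1) && (#|u.2| == i)))) => [|u]; last by rewrite inE.
rewrite -(pair_big_dep xpredT (fun t (B : {set V}) => (B \subset N t) && (#|B| == i))
  (fun _ _ => 1)) /=.
apply: eq_bigr => t _; rewrite -cards_draws -sum1_card.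
by apply: eq_bigl => B; rewrite inE.
Qed.

End AddVertices.

(** * The sequences [m_] and [n_], and their link to [a], [b] and [ck] *)

Lemma bin_floor_le j m1 m2 : 0 < j -> m1 <= m2 -> bin_floor j m1 <= bin_floor j m2.
Proof.
move=> j0 le_m; have /andP[le1 _] := bin_floorP m1 j0.
have /andP[_ lt2] := bin_floorP m2 j0; rewrite leqNgt; apply/negP => lt_f.
have := leq_trans (leq_bin2l _ lt_f) (leq_trans le1 le_m).
by rewrite leqNgt lt2.
Qed.

Lemma m_le k v i : m_ k v i <= m_ k v 0.
Proof. by elim: i => // i IH; apply: leq_trans IH; exact: leq_subr. Qed.

(** The sum telescopes, since [bin_floorP] ensures that no subtraction defining [m_] is
    truncated. *)
Lemma sum_bin_n_ k v j : 1 < k ->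
  \sum_(t < j) 'C(n_ k v t.+1, k.-1) + m_ k v j = m_ k v 0.
Proof.
case: k => // k k0; elim: j => [|j IH]; first by rewrite big_ord0.
rewrite big_ord_recr /= -addnA subnKC //.
by have /andP[] := @bin_floorP k (m_ k.+1 v j) k0.
Qed.

(** [n_ k v i.+1] is [g k (m_ k v i)], so each summand is one unfolding of [ckE]. *)
Lemma sum_bin_n_ck p k v j : 1 < k -> (forall i, i < j -> 0 < m_ k v i) ->
  \sum_(t < j) 'C(n_ k v t.+1, p.-1) + ck p k (m_ k v j) = ck p k (m_ k v 0).
Proof.
move=> k1; elim: j => [|j IH] m0; first by rewrite big_ord0.
rewrite big_ord_recr /= -addnA -[RHS]IH => [|i lt_i]; last by apply: m0; exact: ltnW.
by rewrite (ckE p k1 (m0 j (ltnSn j))).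
Qed.

(** Otherwise [v] would be below ['C(k, k) = 1]. This leaves room in the clique for [p.-1]
    neighbours. *)
Lemma leq_n0 k v : 0 < k -> 0 < v -> k <= n0 k v.
Proof.
move=> k0 v0; have /andP[_] := bin_floorP v k0; rewrite -/(n0 k v).
rewrite [k <= _]leqNgt => lt_v; apply/negP => lt_n0.
have := leq_trans lt_v (leq_bin2l k lt_n0).
by rewrite binn ltnS leqNgt v0.
Qed.

Section Decomposition.

Variables k v a b m : nat.
Hypotheses (k1 : 1 < k) (Ev : v = 'C(a, k) + 'C(b, k.-1) + m).
Hypotheses (lt_ba : b < a) (lt_m : m < 'C(b, k.-2)).

(** Pascal's rule turns the bound on [m] into ['C(b, k.-1) + m < 'C(b.+1, k.-1)]. *)
Lemma bin_floor_decomposition : bin_floor k.-1 ('C(b, k.-1) + m) = b.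
Proof.
case: k k1 lt_m => [|[|j]] // _ lt_mj.
by apply/esym/bin_floor_uniq => //; rewrite leq_addr /= binS ltn_add2l.
Qed.

Lemma n0_decomposition : n0 k v = a.
Proof.
rewrite /n0 Ev; case: k k1 lt_m => [|[|j]] // _ lt_mj.
apply/esym/bin_floor_uniq => //; rewrite -addnA leq_addr /= binS ltn_add2l.
(* The remainder is below ['C(b.+1, k.-1)], which is at most ['C(a, k.-1)] as [b < a]. *)
apply: leq_trans (leq_bin2l _ lt_ba); rewrite binS ltn_add2l; exact: lt_mj.
Qed.

Lemma m0_decomposition : m_ k v 0 = 'C(b, k.-1) + m.
Proof. by rewrite /= n0_decomposition Ev -addnA addKn. Qed.

(** [m_] decreases from [m_ k v 0], whose floor is [b], so every [n_] is at most [b < a]. Hence the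
    required neighbourhoods fit in the clique. *)
Lemma n_lt i : n_ k v i.+1 < n0 k v.
Proof.
rewrite n0_decomposition (leq_ltn_trans _ lt_ba) //.
rewrite -[leqRHS]bin_floor_decomposition -m0_decomposition.
by apply: bin_floor_le; [rewrite -ltnS prednK // ltnW | exact: m_le].
Qed.

(** Equality holds by one unfolding unless ['C(b, k.-1) + m = 0]; then the left side is 0 while
    ['C(b, p.-1)] may be positive. *)
Lemma ck_decomposition p : ck p k ('C(b, k.-1) + m) <= 'C(b, p.-1) + ck p k m.
Proof.
have [|pos] := posnP ('C(b, k.-1) + m); first by move=> ->.
by rewrite ckE // {1 2}/g bin_floor_decomposition addKn.
Qed.

End Decomposition.

(** * Existence of the choices, face counts of both stages, and conclusion *)

Lemma exists_card_set (T : finType) n : n <= #|T| -> exists A : {set T}, #|A| = n.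
Proof.
move=> le_n; have : 0 < #|[set A : {set T} | #|A| == n]| by rewrite card_draws bin_gt0.
by case/card_gt0P => A; rewrite inE => /eqP; exists A.
Qed.

Lemma exists_card_family (I T : finType) (n : I -> nat) :
  (forall i, n i <= #|T|) -> exists N : I -> {set T}, forall i, #|N i| = n i.
Proof. by move=> le_n; apply: (fin_all_exists (fun i => exists_card_set (le_n i))). Qed.

Lemma nfaces_first_complex k v (N1 : 'I_(z k v) -> {set 'I_(n0 k v)}) i :
  first_choice N1 ->
  nfaces (first_complex N1) i.+1 =
    'C(n0 k v, i.+1) + \sum_(t < z k v) 'C(n_ k v t.+1, i).
Proof.
move=> cN1; rewrite nfaces_add_vertices => [|t]; last by apply/cliqueP => x y _ _.
by rewrite nfaces_complete_graph; congr (_ + _); apply: eq_bigr => t _; rewrite cN1.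
Qed.

Lemma nfaces_final_complex k p v w (N1 : 'I_(z k v) -> {set 'I_(n0 k v)})
    (N2 : 'I_(missing p w N1) -> {set 'I_(n0 k v)}) i :
  second_choice N2 ->
  nfaces (final_complex N2) i.+1 =
    nfaces (first_complex N1) i.+1 + missing p w N1 * 'C(p.-1, i).
Proof.
move=> cN2; rewrite nfaces_add_vertices => [|t]; last first.
  (* The neighbourhood lies in the original complete graph. *)
  by rewrite clique_base; apply/cliqueP => x y _ _.
congr (_ + _); rewrite -[X in X * _]card_ord -sum_nat_const.
by apply: eq_bigr => t _; rewrite card_imset ?cN2 // => x y [].
Qed.

Theorem theorem2p7 (k p v w a b m : nat)
    (hk : 0 < k) (hp : 0 < p) (hv : 0 < v) (hw : 0 < w) (hpk : p < k)
    (hvabm : v = 'C(a, k) + 'C(b, k.-1) + m)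
    (hba : b < a) (hm : 0 <= m < 'C(b, k.-2))
    (hbound : 'C(a, p) + 'C(b, p.-1) + ck p k m <= w) :
  (exists N1 : 'I_(z k v) -> {set 'I_(n0 k v)}, first_choice N1) /\
  (forall N1 : 'I_(z k v) -> {set 'I_(n0 k v)}, first_choice N1 ->
     ~~ construction_fails p w N1 /\
     (exists N2 : 'I_(missing p w N1) -> {set 'I_(n0 k v)}, second_choice N2) /\
     (forall N2 : 'I_(missing p w N1) -> {set 'I_(n0 k v)}, second_choice N2 ->
        [/\ flag_complex (final_complex N2),
            nfaces (final_complex N2) k = v &
            nfaces (final_complex N2) p = w])).
Proof.
have k1 : 1 < k by exact: leq_ltn_trans hpk.
have {}hm : m < 'C(b, k.-2) by [].
have En0 := n0_decomposition k1 hvabm hba hm.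
have Em0 := m0_decomposition k1 hvabm hba hm.
have [mz mpos] := zP v k1.
split.
  apply: exists_card_family => i; rewrite card_ord ltnW //.
  exact: n_lt k1 hvabm hba hm i.
move=> N1 cN1.
have facesk : nfaces (first_complex N1) k = v.
  rewrite -[X in nfaces _ X](prednK hk) nfaces_first_complex // prednK //.
  (* As [m_] vanishes at [z], the whole sum equals [m_ k v 0]. *)
  have := sum_bin_n_ v (z k v) k1; rewrite mz addn0 => ->.
  by rewrite Em0 En0 addnA.
have facesp : nfaces (first_complex N1) p <= w.
  rewrite -[X in nfaces _ X](prednK hp) nfaces_first_complex // prednK //.
  have := sum_bin_n_ck p k1 mpos; rewrite mz ck0 addn0 => ->.
  rewrite Em0 En0; apply: leq_trans hbound.
  by rewrite -addnA leq_add2l ck_decomposition.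
split; first by rewrite /construction_fails -leqNgt.
split.
  apply: exists_card_family => i; rewrite card_ord.
  apply: leq_trans (leq_n0 hk hv); apply: leq_trans (ltnW hpk); exact: leq_pred.
move=> N2 cN2; split; first exact: clique_complex_flag.
  rewrite -[X in nfaces _ X](prednK hk) nfaces_final_complex // prednK // facesk.
  (* [p.-1 < k.-1], so the added vertices lie in no face with [k] vertices. *)
  by rewrite bin_small ?muln0 ?addn0 // -ltnS !prednK.
rewrite -[X in nfaces _ X](prednK hp) nfaces_final_complex // prednK // binn muln1.
(* [facesp] makes the truncated subtraction exact. *)
by rewrite /missing subnKC.
Qed.
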